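(* Let $q<r$ be positive integers and fix $\varepsilon\in\{1,-1\}$. Let $\mu<\lambda$ (in the dominance order) be partitions of $r$ with all parts $\le q$, and let $\Delta_\lambda,\Delta_\mu$ be the minimal column dimensions possible (over all assignments of types $e,f$ to the parts) using the partitions $\lambda,\mu$ respectively, in a column of width $q$. Then $\Delta_\lambda\le\Delta_\mu$. In particular, if $\mu$ arises from $\lambda=(\lambda^0,\dots,\lambda^s)$ by applying one move to the Young diagram, then: (i) for a move of the first type, equality $\Delta_\lambda=\Delta_\mu$ is only possible if $\lambda^j-\lambda^k=2$; (ii) for a move of the second type, equality $\Delta_\lambda=\Delta_\mu$ is only possible if $\lambda^j=2$.
   Context: Column dimension: for a partition $\lambda=(\lambda^0\ge\dots\ge\lambda^s)$ of $r$ with all parts $\le q$, assign to each part a type $e$ or $f$; let $e^0\ge e^1\ge\cdots$ and $f^0\ge f^1\ge\cdots$ be the type $e$ and type $f$ parts in decreasing order. The box dimension is $\beta=rq-\sum_j(\lambda^j)^2$, the linear correction is $l=q-\sum_j(-1)^je^j-\sum_j(-1)^jf^j$, and the column dimension is $\beta-\varepsilon l$. Dominance order: $\lambda>\mu$ if $\lambda\ne\mu$ and for every $k\geq 1$ the sum of the $k$ largest parts of $\lambda$ is at least the sum of the $k$ largest parts of $\mu$. Moves: a move of the first type replaces $\lambda$ by $(\lambda^0,\dots,\lambda^j-1,\dots,\lambda^k+1,\dots,\lambda^s)$ for some $j<k\le s$ with $\lambda^j-\lambda^k\ge2$, the result being again a partition (weakly decreasing); a move of the second type replaces $\lambda$ by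 $(\lambda^0,\dots,\lambda^j-1,\dots,\lambda^s,1)$ for some $j$ with $\lambda^j\ge2$, the result being again a partition. *)

(* Defs.v *)
From mathcomp Require Import all_boot all_order all_algebra.

Set Implicit Arguments.
Unset Strict Implicit.
Unset Printing Implicit Defensive.

Import Order.TTheory GRing.Theory Num.Theory.

Local Open Scope ring_scope.

Definition is_partition (r : nat) (la : seq nat) : Prop :=
  [/\ sorted geq la, all (leq 1) la & sumn la = r].

Definition parts_le (q : nat) (la : seq nat) : Prop := all (geq q) la.

(* For weakly decreasing sequences, [take k] selects the k largest parts
   (all of them when k exceeds the number of parts). *)
Definition dominates (la mu : seq nat) : Prop :=
  la <> mu /\
  forall k : nat, (1 <= k)%N -> (sumn (take k mu) <= sumn (take k la))%N.

Definition alt_sum (s : seq nat) : int :=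
  \sum_(j < size s) (-1) ^+ j * (nth 0%N s j)%:Z.

(* [true] encodes type e and [false] type f. *)
Definition type_assignment (la : seq nat) := ((size la).-tuple bool)%type.

(* When la is weakly decreasing, so are these two subsequences. *)
Definition e_parts (la : seq nat) (t : type_assignment la) : seq nat :=
  mask t la.
Definition f_parts (la : seq nat) (t : type_assignment la) : seq nat :=
  mask (map negb t) la.

Definition box_dim (q : nat) (la : seq nat) : int :=
  (sumn la * q)%:Z - \sum_(x <- la) (x ^ 2)%:Z.

Definition linear_correction (q : nat) (la : seq nat)
    (t : type_assignment la) : int :=
  q%:Z - alt_sum (e_parts t) - alt_sum (f_parts t).

Definition column_dim (q : nat) (eps : int) (la : seq nat)
    (t : type_assignment la) : int :=
  box_dim q la - eps * linear_correction q t.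

(* The all-e assignment only witnesses that the set of assignments is
   inhabited. *)
Definition min_column_dim (q : nat) (eps : int) (la : seq nat) : int :=
  column_dim q eps
    [arg min_(t < [tuple of nseq (size la) true]) column_dim q eps t]%O.

Definition first_move (la mu : seq nat) (j k : nat) : Prop :=
  [/\ (j < k)%N, (k < size la)%N, (2 <= nth 0 la j - nth 0 la k)%N,
      mu = set_nth 0%N (set_nth 0%N la j (nth 0 la j).-1) k (nth 0 la k).+1
    & sorted geq mu].

Definition second_move (la mu : seq nat) (j : nat) : Prop :=
  [/\ (j < size la)%N, (2 <= nth 0 la j)%N,
      mu = rcons (set_nth 0%N la j (nth 0 la j).-1) 1%N
    & sorted geq mu].

(* Main.v *)
(** Writing [a] for the alternating sum of [la], the sum of the two type-wise
    alternating sums ranges over [[a, 2 * la^0 - a]], with both ends attained.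
    Up to a constant the minimal column dimension is therefore
    [- Phi la - (1 - eps) * la^0] with [Phi la = \sum_i (la^i ^2 - (-1)^i la^i)],
    and the claims reduce to the same claims on [Phi].  A move with
    [d = la^j - la^k] lowers the sum of squares by [2 * (d - 1)] and changes the
    alternating sum by at most [2].  For dominance, one sums by parts, pairing
    the indices [2n] and [2n+1]. *)
Require Import Defs.
From mathcomp Require Import all_boot all_order all_algebra.
From mathcomp Require Import zify ring.

Import Order.TTheory GRing.Theory Num.Theory.

Local Open Scope ring_scope.

Lemma alt_sum_nil : alt_sum [::] = 0.
Proof. by rewrite /alt_sum big_ord0. Qed.

Lemma alt_sum_cons x s : alt_sum (x :: s) = x%:Z - alt_sum s.
Proof.
rewrite /alt_sum big_ord_recl /= expr0 mul1r -sumrN; congr (_ + _).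
by apply: eq_bigr => i _; rewrite exprS mulN1r mulNr.
Qed.

(* The bound on the difference is what makes the induction go through: a new
   largest part exchanges the roles of the sum and the difference. *)
Lemma alt_sum_mask_bounds (s : seq nat) (m : bitseq) :
  sorted geq s -> size m = size s ->
  let E := alt_sum (mask m s) in let F := alt_sum (mask (map negb m) s) in
  [/\ alt_sum s <= E + F, E + F <= (head 0%N s)%:Z *+ 2 - alt_sum s,
      E - F <= alt_sum s & F - E <= alt_sum s].
Proof.
elim: s m => [|x s IHs] [|b m] //= => [_ _|]; first by rewrite alt_sum_nil.
move=> Hs [Hm]; have [h1 h2 h3 h4] := IHs m (path_sorted Hs) Hm.
have hx : (head 0%N s <= x)%N by case: s Hs {IHs Hm h1 h2 h3 h4} => //= y s /andP[].
by case: b; rewrite /= !alt_sum_cons; split; lia.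
Qed.

(** This is [Phi] with [s] padded by zeros up to length [n]. Zeros contribute nothing, so partitions
    of different lengths can be compared termwise over a common range. *)
Definition sq_alt (s : seq nat) (n : nat) : int :=
  \sum_(i < n) ((nth 0%N s i)%:Z ^+ 2 - (-1) ^+ i * (nth 0%N s i)%:Z).

Lemma sum_nth_widen (G : nat -> nat -> int) (s : seq nat) n :
  (forall i, G i 0%N = 0) -> (size s <= n)%N ->
  \sum_(i < n) G i (nth 0%N s i) = \sum_(i < size s) G i (nth 0%N s i).
Proof.
move=> G0 le_sn; rewrite -(big_mkord xpredT (fun i => G i (nth 0%N s i))).
rewrite (big_cat_nat (n := size s)) //= big_mkord.
rewrite [X in _ + X]big_nat [X in _ + X]big1 ?addr0 // => i /andP[le_si _].
by rewrite nth_default.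
Qed.

Lemma sq_altE (s : seq nat) n : (size s <= n)%N ->
  sq_alt s n = \sum_(x <- s) (x ^ 2)%:Z - alt_sum s.
Proof.
move=> le_sn.
rewrite /sq_alt (sum_nth_widen (fun i x => x%:Z ^+ 2 - (-1) ^+ i * x%:Z)) //; last first.
  by move=> i; rewrite mulr0 subr0.
rewrite sumrB (big_nth 0%N) big_mkord; congr (_ - _).
Qed.

Lemma min_column_dimE (q : nat) (eps : int) (s : seq nat) n :
  eps = 1 \/ eps = -1 -> sorted geq s -> (size s <= n)%N ->
  min_column_dim q eps s =
  (sumn s * q)%:Z - eps * q%:Z - sq_alt s n - (1 - eps) * (nth 0%N s 0)%:Z.
Proof.
move=> heps Hs le_sn; rewrite (sq_altE _ _ le_sn) nth0 /min_column_dim.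
set v := RHS.
have lb (t : type_assignment s) : v <= column_dim q eps t.
  have [] := @alt_sum_mask_bounds s t Hs (size_tuple t).
  rewrite /column_dim /box_dim /linear_correction /e_parts /f_parts /v.
  by case: heps => ->; lia.
have [t Ht] : exists t : type_assignment s, column_dim q eps t = v.
  rewrite /column_dim /box_dim /linear_correction /e_parts /f_parts /v.
  case: heps => ->.
    (* For [eps = 1] the sum of the two alternating sums must be least: all parts get the same
       type. *)
    exists [tuple of nseq (size s) true] => /=.
    have -> : map negb (nseq (size s) true) = nseq (size s) false by rewrite map_nseq.
    by rewrite mask_true // mask_false alt_sum_nil; lia.
  case: s {Hs le_sn v lb} => [|x s] /=.
    by exists [tuple] => /=; rewrite alt_sum_nil big_nil; lia.
  (* For [eps = -1] that sum must be greatest: the largest part stands alone against all the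
     others. *)
  exists [tuple of true :: nseq (size s) false] => /=.
  have -> : map negb (nseq (size s) false) = nseq (size s) true by rewrite map_nseq.
  by rewrite mask_true // mask_false !alt_sum_cons alt_sum_nil; lia.
case: arg_minP => // t' _ /(_ t isT); rewrite Ht => le_t'v.
by apply/eqP; rewrite eq_le le_t'v lb.
Qed.

Lemma sumn_take_nth (s : seq nat) k :
  (sumn (take k s))%:Z = \sum_(i < k) (nth 0%N s i)%:Z.
Proof.
elim: s k => [|x s IHs] [|k] /=; rewrite ?big_ord0 //.
  by rewrite big1 // => i _; rewrite nth_nil.
by rewrite big_ord_recl /= PoszD IHs.
Qed.

Section Dominance.

Variables x y : nat -> int.
Hypotheses (x_noninc : forall i, x i.+1 <= x i) (y_noninc : forall i, y i.+1 <= y i).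
Let D k := \sum_(i < k) (x i - y i).
Hypothesis D_ge0 : forall k, 0 <= D k.
Let T n := \sum_(i < n) (x i ^+ 2 - (-1) ^+ i * x i - (y i ^+ 2 - (-1) ^+ i * y i)).

(* Summation by parts: the coefficient [2] of an odd-indexed partial sum is
   shared equally between its two neighbours, which leaves at the pair
   [2n, 2n+1] the term [D * (a + b) - a + b], where [D] is the partial sum
   [D (2n+1)] and [a], [b] are the drops of [x] and [y]. *)
Lemma sum_sq_alt_lower_bound n : D n.*2 * (x n.*2 + y n.*2) <= T n.*2.
Proof.
elim: n => [|n]; first by rewrite /D /T !big_ord0 mul0r.
have := D_ge0 n.*2.+2; have := D_ge0 n.*2.+1; have := D_ge0 n.*2.
rewrite doubleS.
(* Reading the boundary term at index [2n+1] makes the increment depend only on the current pair. *)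
have : D n.*2.+2 * (x n.*2.+2 + y n.*2.+2) <= D n.*2.+2 * (x n.*2.+1 + y n.*2.+1).
  by apply: ler_wpM2l; [exact: D_ge0 | exact: lerD].
have := x_noninc n.*2; have := y_noninc n.*2.
have -> : D n.*2.+2 = D n.*2.+1 + (x n.*2.+1 - y n.*2.+1) by rewrite /D big_ord_recr.
have -> : D n.*2.+1 = D n.*2 + (x n.*2 - y n.*2) by rewrite /D big_ord_recr.
have -> : T n.*2.+2 = T n.*2 + (x n.*2 ^+ 2 - x n.*2 - (y n.*2 ^+ 2 - y n.*2))
    + (x n.*2.+1 ^+ 2 + x n.*2.+1 - (y n.*2.+1 ^+ 2 + y n.*2.+1)).
  rewrite /T !big_ord_recr /= -(signr_odd _ n.*2) -(signr_odd _ n.*2.+1) /= odd_double.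
  by rewrite expr0 expr1 !mul1r !mulN1r !opprK.
move: (D _) (T _) (x n.*2) (y n.*2) (x n.*2.+1) (y n.*2.+1) => E t u u' v v'.
move=> hv' hv le_drop hE hd hd' ht; apply: le_trans le_drop _.
set d := E + (u - u') in hd hd' *.
suff drop_ge0 : 0 <= d * (u - v + (u' - v')) - (u - v) + (u' - v').
  rewrite -subr_ge0 in ht; rewrite -subr_ge0.
  by have := addr_ge0 ht drop_ge0; congr (_ <= _); rewrite /d; ring.
(* If [d = 0], nonnegativity of the neighbouring partial sums gives [u <= u'] and [v' <= v], so
   [u - v <= u' - v']. Otherwise [d >= 1] by integrality, and the expression is at least
   [2 * (u' - v')]. *)
have [d0|d_neq0] := eqVneq d 0; first by rewrite d0 mul0r; lia.
have : 0 <= (d - 1) * (u - v + (u' - v')) by apply: mulr_ge0; lia.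
by lia.
Qed.

End Dominance.

Lemma nth_noninc (s : seq nat) i : sorted geq s -> (nth 0%N s i.+1 <= nth 0%N s i)%N.
Proof.
move=> Hs; have [lt_is|le_si] := ltnP i.+1 (size s); last by rewrite nth_default.
by have /(sortedP 0%N) := Hs; apply.
Qed.

(** The lower bound from summation by parts is a product of nonnegative factors. The even length,
    needed for the pairing, is harmless because of the zero padding. *)
Lemma sq_alt_dominance (s t : seq nat) n :
  sorted geq s -> sorted geq t ->
  (forall k, (sumn (take k t) <= sumn (take k s))%N) ->
  sq_alt t n.*2 <= sq_alt s n.*2.
Proof.
move=> Hs Ht dom; rewrite -subr_ge0 /sq_alt -sumrB.
have D_ge0 k : 0 <= \sum_(i < k) ((nth 0%N s i)%:Z - (nth 0%N t i)%:Z).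
  by rewrite sumrB -!sumn_take_nth subr_ge0 lez_nat.
have noninc (u : seq nat) i : sorted geq u -> (nth 0%N u i.+1)%:Z <= (nth 0%N u i)%:Z.
  by rewrite lez_nat; exact: nth_noninc.
pose x i := (nth 0%N s i)%:Z; pose y i := (nth 0%N t i)%:Z.
have x_noninc i : x i.+1 <= x i by exact: noninc.
have y_noninc i : y i.+1 <= y i by exact: noninc.
apply: le_trans (sum_sq_alt_lower_bound x y x_noninc y_noninc D_ge0 n).
by rewrite mulr_ge0.
Qed.

(** Only the terms at [j] and [k] change. The margin is [2 * (d - 1) - 2], the worst case being [j]
    even and [k] odd. Describing [t] through [nth] allows [k] to be the first index past the end of
    [s], so both types of move are covered. *)
Lemma sq_alt_move (s t : seq nat) j k n :
  (j < k < n)%N -> (nth 0 s k + 2 <= nth 0 s j)%N ->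
  (forall i, nth 0%N t i = if i == k then (nth 0 s k).+1
                           else if i == j then (nth 0 s j).-1 else nth 0 s i)%N ->
  sq_alt t n + (nth 0 s j - nth 0 s k - 2)%N%:Z *+ 2 <= sq_alt s n.
Proof.
move=> /andP[lt_jk lt_kn] hd ht; have lt_jn := ltn_trans lt_jk lt_kn.
have neq_jk : (j == k) = false by rewrite ltn_eqF.
have sum_split (F : nat -> int) : \sum_(i < n) F i =
    F k + (F j + \sum_(i < n | (i != Ordinal lt_kn) && (i != Ordinal lt_jn)) F i).
  rewrite (bigD1 (Ordinal lt_kn)) //=; congr (_ + _).
  by rewrite (bigD1 (Ordinal lt_jn)) //= -val_eqE /= neq_jk.
rewrite /sq_alt (sum_split (fun i => (nth 0 t i)%N%:Z ^+ 2 - (-1) ^+ i * (nth 0 t i)%N%:Z)).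
rewrite (sum_split (fun i => (nth 0 s i)%N%:Z ^+ 2 - (-1) ^+ i * (nth 0 s i)%N%:Z)) /=.
set R := (X in _ + (_ + X) + _ <= _); set R' := (X in _ <= _ + (_ + X)).
have -> : R = R'.
  by apply: eq_bigr => i /andP[/negbTE nk /negbTE nj]; rewrite ht [_ == k]nk [_ == j]nj.
rewrite !ht !eqxx neq_jk.
rewrite -(signr_odd _ j) -(signr_odd _ k).
by case: (odd j); case: (odd k); rewrite ?expr0 ?expr1; lia.
Qed.

Lemma min_column_dim_move (q r : nat) (eps : int) (la mu : seq nat) j k :
  eps = 1 \/ eps = -1 -> is_partition r la -> is_partition r mu ->
  (j < k)%N -> (nth 0 la k + 2 <= nth 0 la j)%N ->
  (forall i, nth 0%N mu i = if i == k then (nth 0 la k).+1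
                           else if i == j then (nth 0 la j).-1 else nth 0 la i)%N ->
  min_column_dim q eps la <= min_column_dim q eps mu /\
  (min_column_dim q eps la = min_column_dim q eps mu ->
   (nth 0 la j - nth 0 la k = 2)%N).
Proof.
move=> heps [sla _ rla] [smu _ rmu] lt_jk hd hmu.
pose n := maxn k.+1 (maxn (size la) (size mu)).
have lt_jkn : (j < k < n)%N by rewrite /n; lia.
have := sq_alt_move _ _ _ _ _ lt_jkn hd hmu.
rewrite !(min_column_dimE q eps _ n heps) ?rla ?rmu //; [|by rewrite /n; lia..].
(* Since [1 - eps >= 0], the term in the largest part preserves the inequality once that part does
   not grow; [k = 0] is excluded by [j < k]. *)
have : (nth 0 mu 0 <= nth 0 la 0)%N by rewrite hmu; case: ifP => [/eqP k0|_]; [lia | case: ifP => [/eqP <-|_]; lia].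
by case: heps => -> *; split; lia.
Qed.

Theorem proposition4p5 (q r : nat) (eps : int) (la mu : seq nat)
    (hq : (0 < q)%N) (hqr : (q < r)%N) (heps : eps = 1 \/ eps = -1)
    (hla : is_partition r la) (hlaq : parts_le q la)
    (hmu : is_partition r mu) (hmuq : parts_le q mu) :
  [/\ dominates la mu ->
        min_column_dim q eps la <= min_column_dim q eps mu,
      forall j k : nat, first_move la mu j k ->
        min_column_dim q eps la <= min_column_dim q eps mu /\
        (min_column_dim q eps la = min_column_dim q eps mu ->
         (nth 0 la j - nth 0 la k = 2)%N)
    & forall j : nat, second_move la mu j ->
        min_column_dim q eps la <= min_column_dim q eps mu /\
        (min_column_dim q eps la = min_column_dim q eps mu ->
         nth 0%N la j = 2%N)].
Proof.
split=> [[_ dom]|j k|j].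
- have [[sla _ rla] [smu _ rmu]] := (hla, hmu).
  have {}dom k : (sumn (take k mu) <= sumn (take k la))%N.
    by case: k => [|k]; [rewrite !take0 | exact: dom].
  (* Dominance of the first partial sums controls the term [(1 - eps) * la^0]. *)
  have dom1 : (nth 0 mu 0 <= nth 0 la 0)%N.
    by have := dom 1%N; rewrite -lez_nat !sumn_take_nth !big_ord1.
  pose n := maxn (size la) (size mu).
  have := sq_alt_dominance _ _ n sla smu dom.
  by rewrite !(min_column_dimE q eps _ n.*2 heps) ?rla ?rmu // /n; lia.
- move=> [lt_jk lt_k hd def_mu _].
  apply: (@min_column_dim_move q r eps la mu j k) => //; first by lia.
  by move=> i; rewrite def_mu !nth_set_nth /= nth_set_nth.
- move=> [lt_j hd def_mu _].
  (* A second move transfers a box to the zero just past the last part, so the difference of the two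
     entries is [la^j] itself. *)
  have la0 : nth 0%N la (size la) = 0%N by rewrite nth_default.
  have := @min_column_dim_move q r eps la mu j (size la) heps hla hmu lt_j.
  rewrite la0 subn0; apply=> // i.
  rewrite def_mu nth_rcons size_set_nth nth_set_nth /= (maxn_idPr lt_j).
  case: (ltngtP i (size la)) => // lt_i.
  by rewrite (nth_default _ (ltnW lt_i)); case: eqP => // ij; lia.
Qed.
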